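(* Let $G$ be a finite simple connected graph containing at least one cycle, and let $g$ be the girth of $G$. Then $n(G)\geq\lceil\frac{g}{2}\rceil-1$. Moreover, equality $n(G)=\lceil\frac{g}{2}\rceil-1$ holds if and only if either $G$ is isomorphic to a cycle $C_n$ with $n\equiv 0$ or $1 \pmod 4$, or $G$ is isomorphic to a complete bipartite graph $K_{s,t}$ with $s+t\geq 5$.
   Context: For a graph $G$, $n(G)$ denotes the negative inertia index of $G$, i.e. the number of negative eigenvalues, counted with multiplicity, of the adjacency matrix $A(G)$. The girth of $G$ is the length of a shortest cycle of $G$. $C_n$ denotes the cycle on $n$ vertices, and $K_{s,t}$ denotes the complete bipartite graph with parts of sizes $s$ and $t$. *)

(* Defs.v *)
From mathcomp Require Import all_boot all_order all_algebra.
From mathcomp Require Import polyrcf.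

Set Implicit Arguments.
Unset Strict Implicit.
Unset Printing Implicit Defensive.

Import Order.TTheory GRing.Theory Num.Theory.

Local Open Scope ring_scope.

(* A finite simple graph is a symmetric irreflexive relation on a finType;
   the definitions below take the bare relation. *)

Definition adj_mx (R : nzRingType) (T : finType) (e : rel T) : 'M[R]_#|T| :=
  \matrix_(i, j) (e (enum_val i) (enum_val j))%:R.

(* [rootsR p] lists each real root of p once. *)
Definition neg_inertia (R : rcfType) (T : finType) (e : rel T) : nat :=
  let p := char_poly (adj_mx R e) in
  (\sum_(x <- rootsR p | (x < 0)%R) mup x p)%N.

Definition has_cycle (T : finType) (e : rel T) (k : nat) : bool :=
  (2 < k)%N && [exists c : k.-tuple T, ucycleb e c].

Definition girth (T : finType) (e : rel T) (He : exists k, has_cycle e k) : nat :=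
  ex_minn He.

Definition graph_iso (T U : finType) (e : rel T) (e' : rel U) : Prop :=
  exists2 f : T -> U, bijective f & forall x y, e' (f x) (f y) = e x y.

(* This is the cycle on n vertices only for n >= 3. *)
Definition cycle_graph (n : nat) : rel 'I_n :=
  fun i j => (j == i.+1 %[mod n])%N || (i == j.+1 %[mod n])%N.

Definition complete_bipartite (s t : nat) : rel ('I_s + 'I_t)%type :=
  fun x y => match x, y with
             | inl _, inr _ | inr _, inl _ => true
             | _, _ => false
             end.

(* Main.v *)
Require Import Defs.
From mathcomp Require Import all_boot all_order all_algebra.
From mathcomp Require Import boolp reals.
From mathcomp Require Import sesquilinear spectral polyrcf complex ring lra zify.

(** Sylvester's law of inertia turns both halves of the theorem into statements
    about the quadratic form [graph_form e X], the sum of [X u * X v] over all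
    ordered pairs of adjacent vertices.  Since the adjacency matrix is
    unitarily diagonalisable with real eigenvalues, the negative inertia index
    is at least [d] as soon as the form is negative definite on a
    [d]-dimensional space ([leq_neg_inertia]), and at most [d] as soon as the
    form is nonnegative where [d] linear forms vanish ([geq_neg_inertia]).  In
    particular an induced subgraph has at most the index of the whole graph
    ([leq_neg_inertia_pullback]).

    The forms of long cycles are computed by peeling off hyperbolic planes.
    Four consecutive vertices can be removed from a cycle: if [a] and [b] are
    the values at the neighbours of the removed path [x1 x2 x3 x4], then
      [a x1 + x1 x2 + x2 x3 + x3 x4 + x4 b
         = a b + (x2 + a) (x1 - b) + (x2 + x4) (x3 + b)],
    so the index of a cycle grows by exactly 2 when its length grows by 4, and
    starts, for the lengths 1, 2, 3 and 4, with 0, 1, 2 and 1.  A path loses one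
    such plane when it loses two vertices at an end, and so does a cycle with a
    pendant vertex when it loses that vertex and its neighbour.

    A shortest cycle, of length [g], is an induced subgraph, which gives the
    inequality, and equality forces [g] to be 0 or 1 modulo 4
    ([neg_inertia_girth]).  If that cycle covers the graph, the graph is the
    cycle.  Otherwise some vertex outside is adjacent to it.  When [g >= 5] this
    vertex has a single neighbour on the cycle, and the cycle with a pendant
    vertex has a larger index ([neg_inertia_outer]).  When [g = 4], equality
    means that the index is 1, so the graph has no triangle and no induced path
    on 4 vertices, which for a connected graph means that it is complete
    bipartite ([neg_inertia1_bipartite]).  Conversely, the form of a complete
    bipartite graph is twice the product of two linear forms, so its index is at
    most 1; and in a cycle graph the shortest cycle is the whole graph because
    all degrees are 2 ([cycle_graph_cover]). *)

Set Implicit Arguments.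
Unset Strict Implicit.
Unset Printing Implicit Defensive.

Import Order.TTheory GRing.Theory Num.Theory.

Local Open Scope ring_scope.

(** * Negative roots of a split polynomial *)

Lemma mup_prod_XsubC (F : fieldType) (s : seq F) (a : F) :
  mup a (\prod_(x <- s) ('X - x%:P)) = count_mem a s.
Proof.
elim: s => [|x s IHs]; first by rewrite big_nil mupNroot // root1.
rewrite big_cons mupM ?polyXsubC_eq0 ?monic_neq0 ?monic_prod_XsubC //.
by rewrite IHs /= -['X - _]expr1 mup_XsubCX; case: eqVneq.
Qed.

Lemma sum_mup_negative_roots (R : rcfType) (s : seq R) (p : {poly R}) :
  p = \prod_(x <- s) ('X - x%:P) ->
  (\sum_(x <- rootsR p | (x < 0)%R) mup x p)%N = count (fun x : R => x < 0) s.
Proof.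
move=> p_def; have p0 : p != 0 by rewrite p_def monic_neq0 ?monic_prod_XsubC.
have in_roots x : (x \in rootsR p) = (x \in s).
  have /(_ x) := roots_on_rootsR p0.
  by rewrite inE /= => <-; rewrite p_def root_prod_XsubC.
have u_roots : uniq (rootsR p) by apply: uniq_roots.
have mupE x : mup x p = (\sum_(y <- s) (y == x))%N.
  rewrite p_def mup_prod_XsubC -sum1_count big_mkcond /=.
  by apply: eq_bigr => y _; case: (y == x).
under eq_bigr => x _ do rewrite mupE.
rewrite exchange_big /= -sum1_count [RHS]big_mkcond /=.
apply: eq_big_seq => y ys.
rewrite big_mkcond (bigD1_seq y) ?in_roots //= eqxx.
rewrite big1 ?addn0 // => x xy; rewrite eq_sym (negPf xy); by case: ifP.
Qed.

(** * Spectral decomposition of a real symmetric matrix *)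

(** The quadratic form of [A], on row vectors. *)
Definition qform (R : rcfType) n (A : 'M[R]_n) (x : 'rV[R]_n) : R :=
  (x *m A *m x^T) 0 0.

Lemma char_poly_conj (F : fieldType) n (P A : 'M[F]_n) : P \in unitmx ->
  char_poly (invmx P *m A *m P) = char_poly A.
Proof.
move=> Pu; pose p := map_mx polyC P; pose p' := map_mx polyC (invmx P).
have pp : p' *m p = 1%:M by rewrite -map_mxM mulVmx // map_mx1.
rewrite /char_poly.
have -> : char_poly_mx (invmx P *m A *m P) = p' *m char_poly_mx A *m p.
  rewrite /char_poly_mx !map_mxM mulmxBr mulmxBl; congr (_ - _).
  by rewrite mul_mx_scalar -scalemxAl pp scalemx1.
rewrite !det_mulmx mulrAC -det_mulmx.
by rewrite pp det1 mul1r.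
Qed.

Section Spectral.
Variable R : rcfType.
Local Notation C := R[i].
Local Notation re := (@complex.Re R).
Local Notation im := (@complex.Im R).
Local Notation toC := (real_complex R).

Lemma Re_sum (I : finType) (F : I -> C) : re (\sum_i F i) = \sum_i re (F i).
Proof. by apply: (big_morph re) => // -[a b] [c d]. Qed.

Lemma Im_sum (I : finType) (F : I -> C) : im (\sum_i F i) = \sum_i im (F i).
Proof. by apply: (big_morph im) => // -[a b] [c d]. Qed.

Lemma map_Re_mulmx m n p (B : 'M[C]_(m, n)) (M : 'M[R]_(n, p)) :
  map_mx re (B *m map_mx toC M) = map_mx re B *m M.
Proof.
apply/matrixP=> i j; rewrite !mxE Re_sum; apply: eq_bigr => k _; rewrite !mxE.
by case: (B i k) => a b /=; rewrite mulr0 subr0.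
Qed.

Lemma map_Im_mulmx m n p (B : 'M[C]_(m, n)) (M : 'M[R]_(n, p)) :
  map_mx im (B *m map_mx toC M) = map_mx im B *m M.
Proof.
apply/matrixP=> i j; rewrite !mxE Im_sum; apply: eq_bigr => k _; rewrite !mxE.
by case: (B i k) => a b /=; rewrite mulr0 add0r.
Qed.

Lemma Re_mul_conj (x y : C) : re (x * Num.conj y) = re x * re y + im x * im y.
Proof. by case: x y => [a b] [c d] /=; rewrite mulrN opprK. Qed.

Lemma Re_hermitian_form n (A : 'M[R]_n) (x : 'rV[C]_n) :
  re ((x *m map_mx toC A *m (map_mx (@Num.conj C) x)^T) 0 0) =
  qform A (map_mx re x) + qform A (map_mx im x).
Proof.
rewrite /qform -map_Re_mulmx -map_Im_mulmx [in LHS]mxE Re_sum.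
rewrite [in X in _ = X + _]mxE [in X in _ = _ + X]mxE -big_split /=.
by apply: eq_bigr => k _; rewrite !mxE Re_mul_conj.
Qed.

(** Spectral theorem in the shape used below: in the coordinates [y] of
    an eigenbasis over [R[i]], the Hermitian extension of the real form,
    which is the sum of its values at the real and imaginary parts, is
    diagonal. *)
Lemma symmetric_spectral n (A : 'M[R]_n) : A^T = A ->
  exists (r : 'I_n -> R) (P : 'M[C]_n),
    [/\ P \in unitmx, char_poly A = \prod_i ('X - (r i)%:P) &
     forall y : 'rV[C]_n,
       qform A (map_mx re (y *m P)) + qform A (map_mx im (y *m P))
       = \sum_i r i * (re (y 0 i) ^+ 2 + im (y 0 i) ^+ 2)].
Proof.
move=> symA; pose AC := map_mx toC A.
have hermA : AC \is hermsymmx.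
  apply: realsym_hermsym.
    by apply/is_hermitianmxP; rewrite expr0 scale1r map_mx_id // /AC map_trmx symA.
  by apply/mxOverP=> i j; rewrite mxE complex_real.
pose P := spectralmx AC; pose D := spectral_diag AC.
have P_unit : P \in unitmx := spectral_unit AC.
have defA : AC = invmx P *m diag_mx D *m P.
  by apply/orthomx_spectralP/hermitian_normalmx.
have /mxOverP realD := hermitian_spectral_diag_real hermA.
have PP : P *m (map_mx (@Num.conj C) P)^T = 1%:M.
  by have /unitarymxP := spectral_unitarymx AC; rewrite map_trmx.
exists (fun i => re (D 0 i)), P; split=> //.
  apply: (map_inj_poly (@complexI R)) => //.
  rewrite map_char_poly -/AC rmorph_prod /= defA.
  rewrite char_poly_conj // char_poly_trig ?diag_mx_is_trig //.
  apply: eq_bigr => i _; rewrite !mxE eqxx mulr1n rmorphB /= map_polyX map_polyC /=.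
  by rewrite RRe_real.
move=> y; rewrite -Re_hermitian_form -/AC defA.
have -> : y *m P *m (invmx P *m diag_mx D *m P) *m (map_mx (@Num.conj C) (y *m P))^T
   = y *m diag_mx D *m (map_mx (@Num.conj C) y)^T.
  rewrite map_mxM trmx_mul !mulmxA mulmxK //.
  by rewrite -(mulmxA _ P) PP mulmx1.
rewrite mxE Re_sum; apply: eq_bigr => i _.
rewrite mul_mx_diag !mxE -{1}(RRe_real (realD 0 i)).
by case: (y 0 i) => a b /=; ring.
Qed.
End Spectral.

(** * Subspace bounds for the number of negative eigenvalues *)

Lemma wide_kernel (F : fieldType) d k (M : 'M[F]_(d, k)) : (k < d)%N ->
  exists2 s : 'rV_d, s != 0 & s *m M = 0.
Proof.
move=> ltkd; have : kermx M != 0.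
  rewrite kermx_eq0 -row_leq_rank -ltnNge.
  exact: leq_ltn_trans (rank_leq_col M) ltkd.
by case/rowV0Pn=> s /sub_kermxP sM s0; exists s.
Qed.

(** [r] and [P] stand for the eigenvalues and the eigenbasis provided by
    [symmetric_spectral]. *)
Section MinMax.
Variables (R : rcfType) (n : nat) (A : 'M[R]_n).
Variables (r : 'I_n -> R) (P : 'M[R[i]]_n).
Hypothesis P_unit : P \in unitmx.
Local Notation re := (@complex.Re R).
Local Notation im := (@complex.Im R).
Local Notation toC := (real_complex R).
Hypothesis diagE : forall y : 'rV[R[i]]_n,
  qform A (map_mx re (y *m P)) + qform A (map_mx im (y *m P))
  = \sum_i r i * (re (y 0 i) ^+ 2 + im (y 0 i) ^+ 2).

Let neg : {pred 'I_n} := [pred i | r i < 0].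
(** Rows of the identity matrix at the indices of negative eigenvalues. *)
Let coord_neg : 'M[R[i]]_(#|neg|, n) :=
  \matrix_(j, i) (enum_val j == i)%:R.

Lemma row_neq0_ReIm d (s : 'rV[R[i]]_d) : s != 0 ->
  map_mx re s != 0 \/ map_mx im s != 0.
Proof.
have [reE|] := eqVneq (map_mx re s) 0; last by left.
have [imE|] := eqVneq (map_mx im s) 0; last by right.
case/eqP; apply/rowP=> i.
move: (congr1 (fun M : 'rV_d => M 0 i) reE) (congr1 (fun M : 'rV_d => M 0 i) imE).
by rewrite !mxE; case: (s 0 i) => a b /= -> ->.
Qed.

Lemma qform0 : qform A 0 = 0.
Proof. by rewrite /qform !mul0mx mxE. Qed.

(** If [d] exceeded the number of negative eigenvalues, some nonzero vector in
    the row space of [B] would have no component along them. *)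
Lemma negative_definite_subspace_leq d (B : 'M[R]_(d, n)) :
  (forall s : 'rV_d, s != 0 -> qform A (s *m B) < 0) -> (d <= #|neg|)%N.
Proof.
move=> Bneg; rewrite leqNgt; apply/negP=> ltd.
have [s s0 sM] := wide_kernel (map_mx toC B *m invmx P *m coord_neg^T) ltd.
pose y := s *m map_mx toC B *m invmx P.
have y0 i : r i < 0 -> y 0 i = 0.
  move=> ri; have negi : i \in neg by [].
  have := congr1 (fun M : 'rV_ _ => M 0 (enum_rank_in negi i)) sM.
  rewrite !mulmxA -/y [LHS]mxE [RHS]mxE (bigD1 i) //= [_^T i _]mxE [coord_neg _ _]mxE.
  rewrite enum_rankK_in // eqxx mulr1 big1 ?addr0 // => k ki.
  by rewrite [_^T k _]mxE [coord_neg _ _]mxE enum_rankK_in // eq_sym (negPf ki) mulr0.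
have qle (s' : 'rV_d) : qform A (s' *m B) <= 0.
  by have [->|/Bneg/ltW//] := eqVneq s' 0; rewrite mul0mx qform0.
have := diagE y; rewrite mulmxKV // map_Re_mulmx map_Im_mulmx => E.
have : 0 <= \sum_i r i * (re (y 0 i) ^+ 2 + im (y 0 i) ^+ 2).
  apply: sumr_ge0 => i _; case: (ltP (r i) 0) => [/y0->|ri].
    by rewrite /= expr0n /= addr0 mulr0.
  by rewrite mulr_ge0 ?addr_ge0 ?sqr_ge0.
rewrite -E leNgt => /negP; apply.
move: (qle (map_mx re s)) (qle (map_mx im s)).
by case: (row_neq0_ReIm s0) => /Bneg; lra.
Qed.

(** If there were more than [d] negative eigenvalues, some nonzero combination
    of their eigenvectors would be annihilated by [N]. *)
Lemma nonneg_subspace_geq d (N : 'M[R]_(n, d)) :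
  (forall x : 'rV_n, x *m N = 0 -> 0 <= qform A x) -> (#|neg| <= d)%N.
Proof.
move=> Npos; rewrite leqNgt; apply/negP=> ltd.
have [s s0 sM] := wide_kernel (coord_neg *m P *m map_mx toC N) ltd.
pose y := s *m coord_neg.
have y_neg j : y 0 (enum_val j) = s 0 j.
  rewrite mxE (bigD1 j) //= mxE eqxx mulr1 big1 ?addr0 // => k kj.
  by rewrite mxE (inj_eq enum_val_inj) (negPf kj) mulr0.
have y0 i : 0 <= r i -> y 0 i = 0.
  move=> ri; rewrite mxE big1 // => j _; rewrite mxE.
  case: eqP => [ji|]; last by rewrite mulr0.
  have : r (enum_val j) < 0 := enum_valP j; by rewrite ji ltNge ri.
have := diagE y; move: sM; rewrite !mulmxA -/y => sM.
have : 0 <= qform A (map_mx re (y *m P)) + qform A (map_mx im (y *m P)).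
  apply: addr_ge0; apply: Npos; rewrite -?map_Re_mulmx -?map_Im_mulmx sM;
    by apply/matrixP=> i j; rewrite !mxE.
move=> ge0 E; move: ge0; rewrite E leNgt => /negP; apply.
have [j sj0] : exists j, s 0 j != 0.
  apply/existsP; apply: contraNT s0; rewrite negb_exists => /forallP sE.
  by apply/eqP/rowP=> j; rewrite mxE; apply/eqP; have := sE j; rewrite negbK.
have term_le0 i : r i * (re (y 0 i) ^+ 2 + im (y 0 i) ^+ 2) <= 0.
  case: (ltP (r i) 0) => [ri|/y0->]; last by rewrite /= expr0n /= addr0 mulr0.
  by rewrite mulr_le0_ge0 ?addr_ge0 ?sqr_ge0 // ltW.
rewrite (bigD1 (enum_val j)) //= y_neg ltr_wnDr ?sumr_le0 //.
have rj : r (enum_val j) < 0 := enum_valP j.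
rewrite nmulr_rlt0 // lt0r addr_ge0 ?sqr_ge0 // andbT.
rewrite paddr_eq0 ?sqr_ge0 // !sqrf_eq0.
by case: (s 0 j) sj0 => a b; rewrite eq_complex.
Qed.
End MinMax.

Section GraphForm.
Variables (R : rcfType).

(** Linearity of a map between spaces of functions.  Functions on [nat] serve
    below as vectors of unspecified length. *)
Definition linear_fun (I J : Type) (F : (I -> R) -> (J -> R)) : Prop :=
  forall a x y j, F (fun i => a * x i + y i) j = a * F x j + F y j.

Lemma linear_fun_sum I J (F : (I -> R) -> (J -> R)) (K : finType)
    (c : K -> R) (f : K -> I -> R) j : linear_fun F ->
  F (fun i => \sum_k c k * f k i) j = \sum_k c k * F (f k) j.
Proof.
move=> linF; elim: (index_enum K) => [|k s IHs].
  rewrite big_nil; have := linF 1 (fun=> 0) (fun=> 0) j.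
  have -> : (fun _ : I => 1 * 0 + 0 : R) = (fun=> 0) by apply: funext=> i; rewrite mulr0 addr0.
  have -> : (fun i => \sum_(k <- [::]) c k * f k i) = (fun=> 0).
    by apply: funext => i; rewrite big_nil.
  by move/eqP; rewrite mul1r -subr_eq0 opprD addNKr oppr_eq0 => /eqP.
have -> : (fun i => \sum_(k <- k :: s) c k * f k i)
    = (fun i => c k * f k i + \sum_(k <- s) c k * f k i).
  by apply: funext => i; rewrite big_cons.
by rewrite linF IHs big_cons.
Qed.

Variables (T : finType) (e : rel T).
Hypothesis e_sym : symmetric e.

(** The quadratic form of the adjacency matrix; each edge is counted twice. *)
Definition graph_form (X : T -> R) : R :=
  \sum_u \sum_v (e u v)%:R * X u * X v.

Lemma qform_adj_mx (x : 'rV[R]_#|T|) :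
  qform (adj_mx R e) x = graph_form (fun u => x 0 (enum_rank u)).
Proof.
rewrite /qform /graph_form exchange_big mxE /=.
rewrite (reindex_onto (@enum_rank T) (@enum_val T T)) => [|i _]; last exact: enum_valK.
apply: eq_big => [v|v _]; first by rewrite enum_rankK eqxx.
rewrite mxE [x^T _ _]mxE mulr_suml.
rewrite (reindex_onto (@enum_rank T) (@enum_val T T)) => [|i _]; last exact: enum_valK.
apply: eq_big => [u|u _]; first by rewrite enum_rankK eqxx.
by rewrite mxE !enum_rankK [_ * _%:R]mulrC.
Qed.

Lemma neg_inertia_spectral : exists (r : 'I_#|T| -> R) (P : 'M[R[i]]_#|T|),
  [/\ P \in unitmx, neg_inertia R e = #|[pred i | r i < 0]| &
    forall y : 'rV[R[i]]_#|T|,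
       qform (adj_mx R e) (map_mx (@complex.Re R) (y *m P))
       + qform (adj_mx R e) (map_mx (@complex.Im R) (y *m P))
       = \sum_i r i * (complex.Re (y 0 i) ^+ 2 + complex.Im (y 0 i) ^+ 2)].
Proof.
have symA : (adj_mx R e)^T = adj_mx R e.
  by apply/matrixP=> i j; rewrite !mxE e_sym.
have [r [P [Pu pE diagE]]] := symmetric_spectral symA.
exists r, P; split=> //; rewrite /neg_inertia.
rewrite (@sum_mup_negative_roots _ [seq r i | i <- enum 'I_#|T|]).
  by rewrite -sum1_count -[RHS]sum1_card big_map big_enum_cond; apply: eq_bigl => i; rewrite inE.
by rewrite big_map big_enum.
Qed.

Lemma leq_neg_inertia d (F : (nat -> R) -> (T -> R)) : linear_fun F ->
  (forall s, (exists2 i, (i < d)%N & s i != 0) -> graph_form (F s) < 0) ->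
  (d <= neg_inertia R e)%N.
Proof.
move=> linF Fneg; have [r [P [Pu -> diagE]]] := neg_inertia_spectral.
pose B : 'M[R]_(d, #|T|) := \matrix_(j, k) F (fun i => (i == j :> nat)%:R) (enum_val k).
apply: (negative_definite_subspace_leq Pu diagE (B := B)) => s s0.
pose s' i := \sum_(j < d) s 0 j * (i == j :> nat)%:R.
have s'E (j : 'I_d) : s' j = s 0 j.
  rewrite /s' (bigD1 j) //= eqxx mulr1 big1 ?addr0 // => k kj.
  by rewrite eq_sym val_eqE (negPf kj) mulr0.
rewrite qform_adj_mx (_ : (fun _ => _) = F s').
  apply: Fneg; have [j sj] : exists j, s 0 j != 0.
    apply/existsP; apply: contraNT s0; rewrite negb_exists => /forallP sE.
    by apply/eqP/rowP=> j; rewrite mxE; apply/eqP; have := sE j; rewrite negbK.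
  by exists (nat_of_ord j); rewrite ?s'E.
apply: funext => u; rewrite /s' linear_fun_sum // mxE.
by apply: eq_bigr => j _; rewrite mxE enum_rankK.
Qed.

Lemma geq_neg_inertia d (N : (T -> R) -> (nat -> R)) : linear_fun N ->
  (forall X, (forall i, (i < d)%N -> N X i = 0) -> 0 <= graph_form X) ->
  (neg_inertia R e <= d)%N.
Proof.
move=> linN Npos; have [r [P [Pu -> diagE]]] := neg_inertia_spectral.
pose B : 'M[R]_(#|T|, d) := \matrix_(k, i) N (fun u => (u == enum_val k)%:R) i.
apply: (nonneg_subspace_geq diagE (N := B)) => x xB.
rewrite qform_adj_mx; apply: Npos => i ltid.
have := congr1 (fun M : 'rV_d => M 0 (Ordinal ltid)) xB.
rewrite [LHS]mxE [RHS]mxE => xBi; rewrite -[RHS]xBi.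
rewrite (_ : (fun _ => _) = (fun u => \sum_k x 0 k * (u == enum_val k)%:R)).
  by rewrite linear_fun_sum //; apply: eq_bigr => k _; rewrite mxE.
apply: funext => u; rewrite (bigD1 (enum_rank u)) //= enum_rankK eqxx mulr1.
rewrite big1 ?addr0 // => k ku.
by rewrite -(inj_eq enum_rank_inj) enum_valK eq_sym (negPf ku) mulr0.
Qed.
End GraphForm.

(** * Quadratic forms of paths and cycles *)

Section Forms.
Variable R : rcfType.
Implicit Types (x s : nat -> R) (q : (nat -> R) -> R).

(** Half the quadratic form of the path with vertices [0, ..., n]. *)
Definition path_form n x : R := \sum_(i < n) x i * x i.+1.

(** Half the quadratic form of the cycle with the [n.+1] vertices
    [0, ..., n].  For [n = 0] it is the form [x 0 ^+ 2], and for [n = 1] the form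
    [2 * x 0 * x 1]: these degenerate cycles start the recursion. *)
Definition cycle_form n x : R := path_form n x + x n * x 0%N.

(** Half the quadratic form of that cycle with the pendant vertex [n.+1]
    attached to the vertex [0]. *)
Definition pendant_form n x : R := cycle_form n x + x 0%N * x n.+1.

(** The form [q] is negative definite on a [d]-dimensional space, parametrized
    linearly by the first [d] entries of [s].  As [F] may also depend on the
    other entries of [s], the form is required to be nonpositive at all [F s],
    and to vanish only when these [d] entries do. *)
Definition neg_subspace q d : Prop :=
  exists2 F : (nat -> R) -> (nat -> R), linear_fun F &
    forall s, q (F s) <= 0 /\ (q (F s) = 0 -> forall i, (i < d)%N -> s i = 0).

(** The form [q] is nonnegative on the common kernel of [d] linear forms. *)
Definition nonneg_cosubspace q d : Prop :=
  exists2 N : (nat -> R) -> (nat -> R), linear_fun N &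
    forall x, (forall i, (i < d)%N -> N x i = 0) -> 0 <= q x.

Lemma path_form_recr n x : path_form n.+1 x = path_form n x + x n * x n.+1.
Proof. by rewrite /path_form big_ord_recr. Qed.

Lemma eq_path_form n x y : (forall i, (i <= n)%N -> x i = y i) ->
  path_form n x = path_form n y.
Proof.
by move=> xy; apply: eq_bigr => i _; rewrite !xy // ltnW.
Qed.

(** Removing four consecutive vertices of a cycle splits off two products of
    independent linear forms. *)
Lemma cycle_form_step n x :
  cycle_form n.+4 x = cycle_form n x
    + (x n.+2 + x n) * (x n.+1 - x 0%N)
    + (x n.+2 + x n.+4) * (x n.+3 + x 0%N).
Proof. rewrite /cycle_form !path_form_recr; ring. Qed.

Lemma neg_cycle_step n d :
  neg_subspace (cycle_form n) d -> neg_subspace (cycle_form n.+4) d.+2.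
Proof.
case=> F linF Fneg.
pose G s i := if (i <= n)%N then F s i
  else if i == n.+1 then F s 0%N - s d
  else if i == n.+2 then s d - F s n
  else if i == n.+3 then - F s 0%N - s d.+1
  else s d.+1 - (s d - F s n).
(* [G s] is chosen so that the two products are [- s d ^+ 2] and
   [- s d.+1 ^+ 2]. *)
exists G => [a x y j|s]; first have L := linF a x y.
  rewrite /G; do ?case: ifP => _; rewrite ?L; ring.
have qG : cycle_form n.+4 (G s) = cycle_form n (F s) - s d ^+ 2 - s d.+1 ^+ 2.
  rewrite cycle_form_step {1}/cycle_form (@eq_path_form n (G s) (F s)); last first.
    by move=> i ilen; rewrite /G ilen.
  rewrite /cycle_form /G leqnn leq0n !eqSS.
  have -> : (n.+1 <= n)%N = false by lia.
  have -> : (n.+2 <= n)%N = false by lia.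
  have -> : (n.+3 <= n)%N = false by lia.
  have -> : (n.+4 <= n)%N = false by lia.
  rewrite !eqxx.
  have -> : n.+1 == n = false by lia.
  have -> : n.+2 == n = false by lia.
  have -> : n.+3 == n = false by lia.
  ring.
have [qle0 q0] := Fneg s; rewrite qG; split=> [|E i ltid].
  by have := sqr_ge0 (s d); have := sqr_ge0 (s d.+1); lra.
have [s1 s2] := (sqr_ge0 (s d), sqr_ge0 (s d.+1)).
have sd : s d ^+ 2 = 0 by lra.
have sd1 : s d.+1 ^+ 2 = 0 by lra.
have /q0 sF : cycle_form n (F s) = 0 by lra.
move/eqP: sd; move/eqP: sd1; rewrite !sqrf_eq0 => /eqP sd1 /eqP sd.
case: (ltnP i d) => [/sF //|ledi].
by have [->|->] : i = d \/ i = d.+1 by lia.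
Qed.

Lemma nonneg_cycle_step n d :
  nonneg_cosubspace (cycle_form n) d -> nonneg_cosubspace (cycle_form n.+4) d.+2.
Proof.
case=> N linN Npos.
exists (fun x i => if (i < d)%N then N x i
  else if i == d then (x n.+2 + x n) - (x n.+1 - x 0%N)
  else (x n.+2 + x n.+4) - (x n.+3 + x 0%N)) => [a x y j|x Nx].
  have L := linN a x y.
  do ?case: ifP => _; rewrite ?L; ring.
have E1 : x n.+2 + x n = x n.+1 - x 0%N.
  by have := Nx d (leqnSn _); rewrite ltnn eqxx => /eqP; rewrite subr_eq0 => /eqP.
have E2 : x n.+2 + x n.+4 = x n.+3 + x 0%N.
  have := Nx d.+1 (ltnSn _).
  have -> : (d.+1 < d)%N = false by lia.
  have -> : d.+1 == d = false by lia.
  by move/eqP; rewrite subr_eq0 => /eqP.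
have : 0 <= cycle_form n x.
  by apply: Npos => i ltid; have := Nx i; rewrite ltid; apply; lia.
have := sqr_ge0 (x n.+1 - x 0%N); have := sqr_ge0 (x n.+3 + x 0%N).
by rewrite cycle_form_step E1 E2; lra.
Qed.

Lemma neg_cycle_iter n d k : neg_subspace (cycle_form n) d ->
  neg_subspace (cycle_form (n + 4 * k)) (d + 2 * k).
Proof.
move=> nd; elim: k => [|k IHk]; first by rewrite !muln0 !addn0.
have -> : (n + 4 * k.+1 = (n + 4 * k).+4)%N by lia.
have -> : (d + 2 * k.+1 = (d + 2 * k).+2)%N by lia.
exact: neg_cycle_step.
Qed.

Lemma nonneg_cycle_iter n d k : nonneg_cosubspace (cycle_form n) d ->
  nonneg_cosubspace (cycle_form (n + 4 * k)) (d + 2 * k).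
Proof.
move=> nd; elim: k => [|k IHk]; first by rewrite !muln0 !addn0.
have -> : (n + 4 * k.+1 = (n + 4 * k).+4)%N by lia.
have -> : (d + 2 * k.+1 = (d + 2 * k).+2)%N by lia.
exact: nonneg_cycle_step.
Qed.

(** The dimension is [uphalf m - 1] for a cycle length [m = n.+1] that is 0 or 1
    modulo 4, and [uphalf m] otherwise. *)
Lemma neg_subspace_cycle n :
  neg_subspace (cycle_form n)
    (uphalf n.+1 - ((n.+1 %% 4 == 0) || (n.+1 %% 4 == 1)))%N.
Proof.
have [k [r ltr4 ->]] : exists k, exists2 r, (r < 4)%N & n = (r + 4 * k)%N.
  by exists (n %/ 4)%N, (n %% 4)%N; [rewrite ltn_mod | rewrite addnC mulnC -divn_eq].
have base d : (uphalf (r + 4 * k).+1 - (((r + 4 * k).+1 %% 4 == 0) || ((r + 4 * k).+1 %% 4 == 1)))%N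
    = (d + 2 * k)%N -> neg_subspace (cycle_form r) d -> neg_subspace (cycle_form (r + 4 * k))
  (uphalf (r + 4 * k).+1 - (((r + 4 * k).+1 %% 4 == 0) || ((r + 4 * k).+1 %% 4 == 1)))%N.
  by move=> ->; exact: neg_cycle_iter.
case: r ltr4 base => [|[|[|[|//]]]] _ base.
- apply: (base 0%N); first lia.
  exists (fun s i => 0) => [a x y j|s]; first by ring.
  by rewrite /cycle_form /path_form big_ord0 mulr0 addr0; split.
- apply: (base 1%N); first lia.
  exists (fun s i => if i == 0%N then s 0%N else - s 0%N) => [a x y j|s].
    by case: ifP => _; ring.
  rewrite /cycle_form /path_form big_ord1 /=.
  have := sqr_ge0 (s 0%N); split=> [|E [|//] _]; first lra.
  by apply/eqP; rewrite -sqrf_eq0; apply/eqP; lra.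
- apply: (base 2%N); first lia.
  exists (fun s i => if i == 0%N then s 0%N else if i == 1%N then s 1%N
                     else - s 0%N - s 1%N) => [a x y j|s].
    by do ?case: ifP => _; ring.
  rewrite /cycle_form /path_form !big_ord_recr big_ord0 /=.
  have [s0 s1] := (sqr_ge0 (s 0%N), sqr_ge0 (s 1%N)).
  have s01 := sqr_ge0 (s 0%N + s 1%N).
  split=> [|E]; first lra.
  have s00 : s 0%N = 0 by apply/eqP; rewrite -sqrf_eq0; apply/eqP; lra.
  have s10 : s 1%N = 0 by apply/eqP; rewrite -sqrf_eq0; apply/eqP; lra.
  by case=> [|[|//]].
- apply: (base 1%N); first lia.
  exists (fun s i => if i == 0%N then s 0%N else if i == 1%N then - s 0%N
                     else 0) => [a x y j|s].
    by do ?case: ifP => _; ring.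
  rewrite /cycle_form /path_form !big_ord_recr big_ord0 /=.
  have := sqr_ge0 (s 0%N); split=> [|E [|//] _]; first lra.
  by apply/eqP; rewrite -sqrf_eq0; apply/eqP; lra.
Qed.

Lemma nonneg_cosubspace_cycle n :
  (n.+1 %% 4 = 0)%N \/ (n.+1 %% 4 = 1)%N ->
  nonneg_cosubspace (cycle_form n) (uphalf n.+1 - 1)%N.
Proof.
case=> nmod.
  have [k ->] : exists k, n = (3 + 4 * k)%N by exists (n %/ 4)%N; lia.
  have -> : (uphalf (3 + 4 * k).+1 - 1 = 1 + 2 * k)%N by lia.
  apply: nonneg_cycle_iter.
  exists (fun x i => x 0%N + x 2%N - (x 1%N + x 3%N)) => [a x y j|x Nx].
    by ring.
  have /eqP := Nx 0%N isT; rewrite subr_eq0 => /eqP E.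
  rewrite /cycle_form /path_form !big_ord_recr big_ord0 /=.
  suff -> : 0 + x 0%N * x 1%N + x 1%N * x 2%N + x 2%N * x 3%N + x 3%N * x 0%N
    = (x 0%N + x 2%N) * (x 1%N + x 3%N) by rewrite E -expr2 sqr_ge0.
  by ring.
have [k ->] : exists k, n = (0 + 4 * k)%N by exists (n %/ 4)%N; lia.
have -> : (uphalf (0 + 4 * k).+1 - 1 = 0 + 2 * k)%N by lia.
apply: nonneg_cycle_iter; exists (fun x => x) => [a x y j //|x _].
by rewrite /cycle_form /path_form big_ord0 add0r -expr2 sqr_ge0.
Qed.

Lemma neg_path_step n d :
  neg_subspace (path_form n) d -> neg_subspace (path_form n.+2) d.+1.
Proof.
case=> F linF Fneg.
pose G s i := if (i <= n)%N then F s i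
  else if i == n.+1 then s d else - s d - F s n.
exists G => [a x y j|s]; first have L := linF a x y.
  rewrite /G; do ?case: ifP => _; rewrite ?L; ring.
have qG : path_form n.+2 (G s) = path_form n (F s) - s d ^+ 2.
  rewrite !path_form_recr (@eq_path_form n (G s) (F s)); last first.
    by move=> i ilen; rewrite /G ilen.
  rewrite /G leqnn !eqSS eqxx.
  have -> : (n.+1 <= n)%N = false by lia.
  have -> : (n.+2 <= n)%N = false by lia.
  have -> : n.+1 == n = false by lia.
  ring.
have [qle0 q0] := Fneg s; rewrite qG; have sd := sqr_ge0 (s d).
split=> [|E i ltid]; first lra.
have /q0 sF : path_form n (F s) = 0 by lra.
case: (ltnP i d) => [/sF //|ledi].
have -> : i = d by lia.
by apply/eqP; rewrite -sqrf_eq0; apply/eqP; lra.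
Qed.

Lemma neg_subspace_path n : neg_subspace (path_form n) (uphalf n).
Proof.
suff /(_ n) [] : forall n, neg_subspace (path_form n) (uphalf n)
                     /\ neg_subspace (path_form n.+1) (uphalf n.+1) by [].
elim=> [|k [IH0 IH1]]; last by split=> //; exact: neg_path_step.
split.
  exists (fun s i => 0) => [a x y j|s]; first by ring.
  by rewrite /path_form big_ord0; split.
exists (fun s i => if i == 0%N then s 0%N else - s 0%N) => [a x y j|s].
  by case: ifP => _; ring.
rewrite /path_form big_ord1 /=.
have := sqr_ge0 (s 0%N); split=> [|E [|//] _]; first lra.
by apply/eqP; rewrite -sqrf_eq0; apply/eqP; lra.
Qed.

(** The pendant vertex and its neighbour form a hyperbolic plane; what remains
    of the cycle is a path, reindexed from the vertex [1]. *)
Lemma neg_subspace_pendant n :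
  neg_subspace (pendant_form n.+1) (uphalf n).+1.
Proof.
have [F linF Fneg] := neg_subspace_path n; set d := uphalf n in Fneg *.
pose G s i := if i is i'.+1 then
    if (i' <= n)%N then F s i' else - s d - F s 0%N - F s n
  else s d.
exists G => [a x y [|j]|s].
- by [].
- rewrite /G; have L := linF a x y; case: ifP => _; rewrite ?L; ring.
have qG : pendant_form n.+1 (G s) = path_form n (F s) - s d ^+ 2.
  rewrite /pendant_form /cycle_form /path_form big_ord_recl /=.
  rewrite (eq_bigr (fun i : 'I_n => F s i * F s i.+1)) => [|i _].
    by rewrite ltnn leqnn; ring.
  by rewrite /bump leq0n add1n /= ltn_ord ltnW ?ltn_ord.
have [qle0 q0] := Fneg s; rewrite qG; have sd := sqr_ge0 (s d).
split=> [|E i ltid]; first lra.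
have /q0 sF : path_form n (F s) = 0 by lra.
case: (ltnP i d) => [/sF //|ledi].
have -> : i = d by lia.
by apply/eqP; rewrite -sqrf_eq0; apply/eqP; lra.
Qed.

(** For [n >= 2] the two clauses of [cycle_graph] are mutually exclusive, so
    that each edge of the cycle contributes twice. *)
Lemma sum_cycle_graph n x : (2 <= n)%N ->
  \sum_(i < n.+1) \sum_(j < n.+1) (@cycle_graph n.+1 i j)%:R * x i * x j
  = 2 * cycle_form n x.
Proof.
move=> n2; pose c (i j : 'I_n.+1) := (j == i.+1 %[mod n.+1])%N.
have cE : \sum_(i < n.+1) \sum_(j < n.+1) (c i j)%:R * x i * x j = cycle_form n x.
  have rowE (i : 'I_n.+1) : \sum_(j < n.+1) (c i j)%:R * x i * x j = x i * x (i.+1 %% n.+1)%N.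
    have lt1 : (i.+1 %% n.+1 < n.+1)%N by rewrite ltn_mod.
    rewrite (bigD1 (Ordinal lt1)) //= /c modn_mod eqxx mul1r big1 ?addr0 // => j.
    rewrite -val_eqE /= (modn_small (ltn_ord j)) => /negPf->.
    by rewrite !mul0r.
  rewrite (eq_bigr _ (fun i _ => rowE i)) big_ord_recr /= modnn; congr (_ + _).
  by apply: eq_bigr => i _; rewrite modn_small // ltnS ltn_ord.
have adjE (i j : 'I_n.+1) : (@cycle_graph n.+1 i j)%:R = (c i j)%:R + (c j i)%:R :> R.
  rewrite /cycle_graph /c; have [ij|//] := eqVneq; last by rewrite add0r.
  case: eqVneq => [ji|_]; last by rewrite addr0.
  have succE (k : 'I_n.+1) : (k.+1 %% n.+1 = if k == n :> nat then 0 else k.+1)%N.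
    by case: eqP => [->|kn]; [rewrite modnn | rewrite modn_small //; have := ltn_ord k; lia].
  move: ij ji; rewrite /= !succE !(modn_small (ltn_ord _)).
  by do 2 case: eqP => ?; lia.
under eq_bigr => i _ do under eq_bigr => j _ do rewrite adjE mulrDl mulrDl.
under eq_bigr => i _ do rewrite big_split /=.
rewrite big_split /= cE [X in _ + X]exchange_big /=.
rewrite (eq_bigr (fun i => \sum_(j < n.+1) (c i j)%:R * x i * x j)) => [|i _].
  by rewrite cE; ring.
by apply: eq_bigr => j _; ring.
Qed.

End Forms.

(** * Index bounds from induced subgraphs *)

Section Pullback.
Variables (R : rcfType) (T : finType) (e : rel T).
Hypothesis e_sym : symmetric e.

Lemma sum_pushforward (I : finType) (psi : I -> T) (x : I -> R) (g : T -> R) :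
  \sum_u g u * (\sum_i (psi i == u)%:R * x i) = \sum_i g (psi i) * x i.
Proof.
under eq_bigr => u _ do rewrite mulr_sumr.
rewrite exchange_big; apply: eq_bigr => i _ /=.
rewrite (bigD1 (psi i)) //= eqxx mul1r big1 ?addr0 // => u.
by rewrite eq_sym => /negPf->; rewrite mul0r mulr0.
Qed.

Lemma graph_form_pushforward (I : finType) (psi : I -> T) (x : I -> R) :
  graph_form e (fun u => \sum_i (psi i == u)%:R * x i)
  = \sum_i \sum_j (e (psi i) (psi j))%:R * x i * x j.
Proof.
pose X u := \sum_i (psi i == u)%:R * x i.
transitivity (\sum_u \sum_j (e u (psi j))%:R * X u * x j).
  by apply: eq_bigr => u _; rewrite -(sum_pushforward psi x (fun v => (e u v)%:R * X u)).
rewrite exchange_big [RHS]exchange_big /=; apply: eq_bigr => j _.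
rewrite (eq_bigr (fun u => (e u (psi j))%:R * x j * X u)) => [|u _]; last by ring.
by rewrite sum_pushforward; apply: eq_bigr => i _; ring.
Qed.

(** The sum in the hypothesis is the form of [e] at the pushforward of [x] along
    [psi]; when [psi] is injective it is the form of the induced subgraph.
    Injectivity is not needed: on a space where the pulled-back form is negative
    definite, the pushforward has no kernel. *)
Lemma leq_neg_inertia_pullback m (psi : nat -> T) q d :
  (forall x : nat -> R,
     \sum_(i < m) \sum_(j < m) (e (psi i) (psi j))%:R * x i * x j = 2 * q x) ->
  neg_subspace q d -> (d <= neg_inertia R e)%N.
Proof.
move=> qE [F linF Fneg].
apply: (@leq_neg_inertia _ _ _ e_sym d
          (fun s u => \sum_(i < m) (psi i == u)%:R * F s i)) => [a x y u|s [i ltid si]].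
  rewrite mulr_sumr -big_split; apply: eq_bigr => i _ /=.
  by rewrite (linF a x y); ring.
rewrite (graph_form_pushforward (fun i : 'I_m => psi i) (fun i => F s i)) qE.
have [qle0 q0] := Fneg s; rewrite pmulr_rlt0 // lt_neqAle qle0 andbT.
by apply: contraNneq si => /q0 ->.
Qed.

Lemma graph_form_bij (I : finType) (h : I -> T) (X : T -> R) : bijective h ->
  graph_form e X = \sum_i \sum_j (e (h i) (h j))%:R * X (h i) * X (h j).
Proof.
move=> bij_h; rewrite /graph_form (reindex h) /=; last exact: onW_bij.
by apply: eq_bigr => i _; rewrite (reindex h) //=; exact: onW_bij.
Qed.

Lemma neg_inertia_cycle_leq n : (2 <= n)%N ->
  (n.+1 %% 4 = 0)%N \/ (n.+1 %% 4 = 1)%N -> graph_iso e (@cycle_graph n.+1) ->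
  (neg_inertia R e <= uphalf n.+1 - 1)%N.
Proof.
move=> n2 /(@nonneg_cosubspace_cycle R)[N linN Npos] [f [h fK hK] fE].
apply: (geq_neg_inertia e_sym (N := fun X => N (fun i => X (h (inord i))))).
  by move=> a x y j; rewrite -linN.
move=> X /Npos Xge0; rewrite (@graph_form_bij _ h); last by exists f.
pose y i := X (h (inord i)) .
rewrite (eq_bigr (fun i : 'I_n.+1 => \sum_(j < n.+1) (@cycle_graph n.+1 i j)%:R * y i * y j)).
  by rewrite sum_cycle_graph // mulr_ge0.
by move=> i _; apply: eq_bigr => j _; rewrite -fE !hK /y !inord_val.
Qed.

Lemma neg_inertia_bipartite_leq (P : pred T) :
  (forall u v, e u v = (P u != P v)) -> (neg_inertia R e <= 1)%N.
Proof.
move=> eE.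
apply: (@geq_neg_inertia _ _ _ e_sym _
  (fun X (_ : nat) => \sum_(u | P u) X u - \sum_(u | ~~ P u) X u)).
  by move=> a x y _; rewrite !big_split /= -!mulr_sumr; ring.
move=> X /(_ 0%N isT)/eqP; rewrite subr_eq0 => /eqP XE.
suff -> : graph_form e X = 2 * (\sum_(u | P u) X u) * (\sum_(u | ~~ P u) X u).
  by rewrite -XE -mulrA mulr_ge0 // -expr2 sqr_ge0.
have rowE u : \sum_v (e u v)%:R * X u * X v
    = X u * (if P u then \sum_(v | ~~ P v) X v else \sum_(v | P v) X v).
  rewrite (eq_bigr (fun v => X u * ((e u v)%:R * X v))) => [|v _]; last by ring.
  rewrite -mulr_sumr; congr (_ * _); case: ifP => Pu; rewrite [RHS]big_mkcond;
    by apply: eq_bigr => v _; rewrite eE Pu; case: (P v); rewrite ?mul1r ?mul0r.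
rewrite /graph_form (eq_bigr _ (fun u _ => rowE u)) (bigID P) /=.
rewrite (eq_bigr (fun u => X u * \sum_(v | ~~ P v) X v)) => [|u ->] //.
rewrite [X in _ + X](eq_bigr (fun u => X u * \sum_(v | P v) X v)) => [|u /negPf->] //.
by rewrite -!mulr_suml; ring.
Qed.

Lemma neg_inertia_triangle a b c : e a b -> e b c -> e a c ->
  irreflexive e -> (2 <= neg_inertia R e)%N.
Proof.
move=> ab bc ac irr.
apply: (@leq_neg_inertia_pullback 3 (nth a [:: a; b; c]) (cycle_form 2) 2);
  last exact: (neg_subspace_cycle R 2).
move=> x; rewrite /cycle_form /path_form !big_ord_recr !big_ord0 /= !irr.
by rewrite (e_sym b a) (e_sym c a) (e_sym c b) ab bc ac /=; ring.
Qed.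

Lemma neg_inertia_P4 a b c d : e a b -> e b c -> e c d ->
  ~~ e a c -> ~~ e a d -> ~~ e b d -> irreflexive e -> (2 <= neg_inertia R e)%N.
Proof.
move=> ab bc cd ac ad bd irr.
apply: (@leq_neg_inertia_pullback 4 (nth a [:: a; b; c; d]) (path_form 3)
         (uphalf 3)); last exact: neg_subspace_path.
move=> x; rewrite /path_form !big_ord_recr !big_ord0 /= !irr.
rewrite (e_sym b a) (e_sym c a) (e_sym d a) (e_sym c b) (e_sym d b) (e_sym d c).
by rewrite ab bc cd (negPf ac) (negPf ad) (negPf bd) /=; ring.
Qed.

End Pullback.

(** * Shortest cycles *)

Section Cycles.
Local Open Scope nat_scope.
Variables (T : finType) (e : rel T).
Hypotheses (e_sym : symmetric e) (e_irr : irreflexive e).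

Lemma has_cycle_intro k (psi : nat -> T) : 2 < k ->
  {in gtn k &, injective psi} -> (forall i, i.+1 < k -> e (psi i) (psi i.+1)) ->
  e (psi k.-1) (psi 0) -> has_cycle e k.
Proof.
move=> k2 inj_psi e_step e_close; rewrite /has_cycle k2 /=.
apply/existsP; exists (Tuple (introT eqP (size_mkseq psi k))).
apply/andP; split; last first.
  rewrite map_inj_in_uniq ?iota_uniq // => i j.
  by rewrite !mem_iota !add0n => ik jk; apply: inj_psi.
rewrite (cycle_path (psi 0)); apply/(pathP (psi 0)) => i.
rewrite /= size_mkseq => ltik; rewrite nth_mkseq //.
case: i ltik => [|i] ltik /=; last by rewrite nth_mkseq ?e_step // ltnW.
rewrite (last_nth (psi 0)) size_mkseq.
by case: k k2 ltik e_close {inj_psi e_step} => // k _ _; rewrite /= nth_mkseq.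
Qed.

(** A simple closed walk of length [g] in [e], unrolled into a [g]-periodic
    sequence of vertices, so that it can be started at any vertex. *)
Definition cycle_param g (phi : nat -> T) : Prop :=
  (forall t, e (phi t) (phi t.+1)) /\
  (forall s t, (phi s == phi t) = (s == t %[mod g])).

Lemma has_cycle_param k : has_cycle e k -> exists phi, cycle_param k phi.
Proof.
case/andP=> k2 /existsP[[c /= /eqP size_c] /andP[c_cyc c_uniq]].
have k0 : 0 < k by lia.
have [x0 _] : exists x0 : T, x0 \in c.
  by case: (c) size_c k0 => [<-//|x s _ _]; exists x; rewrite mem_head.
exists (fun t => nth x0 c (t %% k)); split=> [t|s t]; last first.
  by rewrite nth_uniq // size_c ltn_mod.
move: c_cyc; rewrite (cycle_path x0) => /(pathP x0) c_path.
have tltk : t %% k < k by rewrite ltn_mod.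
have succE : t.+1 %% k = if t %% k == k.-1 then 0 else (t %% k).+1.
  rewrite -addn1 -modnDml; case: eqP => [->|tk].
    by rewrite addn1 prednK // modnn.
  by rewrite addn1 modn_small //; lia.
rewrite succE; case: eqP => [->|tk].
  by have /= := c_path 0; rewrite size_c => /(_ k0); rewrite -nth_last size_c.
by have /= := c_path (t %% k).+1; apply; rewrite size_c; lia.
Qed.

Section Shortest.
Variables (g : nat) (phi : nat -> T).
Hypotheses (g_gt2 : 2 < g) (phi_cyc : cycle_param g phi).
Hypothesis g_min : forall k, has_cycle e k -> g <= k.

Lemma cycle_param_shift s t : exists2 d, d < g & t = s + d %[mod g].
Proof.
exists ((t + s * g.-1) %% g); first by rewrite ltn_mod; lia.
rewrite modnDmr addnCA -mulnS prednK; last by lia.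
by rewrite [t + _]addnC modnMDl.
Qed.

Lemma arc_inj s d : d < g -> {in gtn d.+1 &, injective (fun i => phi (s + i))}.
Proof.
move=> ltdg i j; rewrite !inE => lti ltj /eqP; rewrite phi_cyc.2 eqn_modDl.
by rewrite !modn_small ?(leq_trans _ ltdg) // => /eqP.
Qed.

(** A shortest cycle is induced: a chord would close a shorter cycle with one of
    the two arcs that it cuts. *)
Lemma shortest_cycle_adj s t :
  e (phi s) (phi t) = (t == s.+1 %[mod g]) || (s == t.+1 %[mod g]).
Proof.
have phiE a b : a = b %[mod g] -> phi a = phi b.
  by move/eqP; rewrite -phi_cyc.2 => /eqP.
apply/idP/orP=> [est|]; last first.
  by case=> /eqP/phiE->; [|rewrite e_sym]; apply: phi_cyc.1.
have [d ltdg tE] := cycle_param_shift s t.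
rewrite tE; have := est; rewrite (phiE _ _ tE).
case: d ltdg tE => [|[|d]] ltdg tE.
- by rewrite addn0 e_irr.
- by rewrite addn1; left.
move=> chord; right.
have /g_min gd : has_cycle e d.+3.
  apply: (has_cycle_intro (psi := fun i => phi (s + i))) => //.
  - exact: arc_inj.
  - by move=> i _; rewrite addnS phi_cyc.1.
  - by rewrite /= addn0 e_sym.
have gE : g = d.+3 by lia.
apply/eqP; rewrite -addn1 -modnDml tE modnDml gE.
by rewrite -addnA addn1 modnDr.
Qed.

(** Two neighbours of [v] on the cycle would give two cycles through [v], of
    lengths [d + 2] and [g - d + 2] for arcs of lengths [d] and [g - d]; both
    are at least [g] only if [g <= 4]. *)
Lemma shortest_cycle_outer v s t : 4 < g -> (forall i, v != phi i) ->
  e v (phi s) -> e v (phi t) = (s == t %[mod g]).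
Proof.
move=> g_gt4 v_out evs.
have phiE a b : a = b %[mod g] -> phi a = phi b.
  by move/eqP; rewrite -phi_cyc.2 => /eqP.
apply/idP/idP=> [evt|/eqP/phiE<-//].
have [d ltdg tE] := cycle_param_shift s t.
rewrite tE; move: evt; rewrite (phiE _ _ tE).
case: d ltdg tE => [|d] ltdg tE evt; first by rewrite addn0.
(* The cycle made of [v] and of the arc of length [b] starting at [phi a]. *)
have close a b : 0 < b -> b < g -> e v (phi a) -> e v (phi (a + b)) -> g <= b.+2.
  move=> b0 ltbg eva evb; apply: g_min.
  apply: (has_cycle_intro (psi := fun i => if i <= b then phi (a + i) else v)) => //.
  - move=> i j; rewrite !inE !ltnS => lti ltj.
    case: leqP => ib; case: leqP => jb.
    + by apply: (arc_inj ltbg); rewrite inE ltnS.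
    + by move/eqP; rewrite eq_sym (negPf (v_out _)).
    + by move/eqP; rewrite (negPf (v_out _)).
    + by move=> _; lia.
  - move=> i; rewrite !ltnS => lei; rewrite lei.
    case: ltnP => ib; first by rewrite addnS phi_cyc.1.
    by have -> : i = b by [lia]; rewrite e_sym.
  - by rewrite /= ltnn addn0.
have := close s d.+1 isT ltdg evs evt.
have := close (s + d.+1) (g - d.+1).
rewrite -addnA subnKC ?(ltnW ltdg) // (phiE (s + g) s) ?modnDr // => /(_ _ _ evt evs).
by lia.
Qed.
End Shortest.
End Cycles.

(** * Shape of the graph around a shortest cycle *)

Section Structure.
Variables (R : rcfType) (T : finType) (e : rel T).
Hypotheses (e_sym : symmetric e) (e_irr : irreflexive e).
Hypothesis e_conn : forall x y : T, connect e x y.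

(** [a] and [b] only witness that both sides are inhabited, which provides the
    default values of [enum_rank_in]. *)
Lemma complete_bipartite_iso (P : pred T) (a b : T) : P a -> ~~ P b ->
  (forall u v, e u v = (P u != P v)) ->
  exists s t, (s + t)%N = #|T| /\ graph_iso e (@complete_bipartite s t).
Proof.
move=> Pa Pb eE; pose A := [set u | P u].
have Aa : a \in A by rewrite inE.
have Ab : b \in ~: A by rewrite !inE.
exists #|A|, #|~: A|; split; first exact: cardsC.
pose f u : 'I_#|A| + 'I_#|~: A| :=
  if P u then inl (enum_rank_in Aa u) else inr (enum_rank_in Ab u).
exists f; last by move=> u v; rewrite /f eE; case: (P u); case: (P v).
apply: inj_card_bij; last by rewrite card_sum !card_ord cardsC.
move=> u v; rewrite /f; case: ifP => Pu; case: ifP => Pv // [].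
  by move/(congr1 enum_val); rewrite !enum_rankK_in ?inE.
by move/(congr1 enum_val); rewrite !enum_rankK_in ?inE ?Pu ?Pv.
Qed.

(** A connected graph with an edge and at most one negative eigenvalue has
    neither a triangle nor an induced path on 4 vertices, hence is complete
    bipartite; the sides are told apart by adjacency to [b]. *)
Lemma neg_inertia1_bipartite a b : e a b ->
  (neg_inertia R e <= 1)%N -> forall u v, e u v = (e u b != e v b).
Proof.
move=> eab n1.
have no_triangle x y z : e x y -> e y z -> ~~ e x z.
  move=> xy yz; apply: contraL n1 => xz; rewrite -ltnNge.
  exact: (neg_inertia_triangle R e_sym xy yz xz).
(* Without triangles and induced 4-vertex paths, the ends of every walk of
   length 3 are adjacent. *)
have walk3 x y z w : e x y -> e y z -> e z w -> e x w.
  move=> xy yz zw; apply: contraLR n1 => xw; rewrite -ltnNge.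
  apply: (neg_inertia_P4 R e_sym xy yz zw) => //.
    exact: no_triangle yz.
  exact: no_triangle zw.
have dom u : e u a || e u b.
  have clos : closed e [pred u | e u a || e u b].
    apply: intro_closed => [x y|x y exy /orP[xa|xb]]; first by rewrite !e_conn.
      by rewrite inE (walk3 y x a b) ?orbT // e_sym.
    by rewrite inE (walk3 y x b a) // e_sym.
  have := closed_connect clos (e_conn b u); rewrite !inE e_sym eab => /esym/=.
  by [].
have domN u : ~~ e u b -> e u a by move/negPf=> ub; have := dom u; rewrite ub orbF.
move=> u v; case ub: (e u b); case vb: (e v b) => /=.
- by apply/negbTE/(no_triangle u b v) => //; rewrite e_sym.
- by rewrite e_sym (walk3 v a b u) ?domN ?vb // e_sym.
- by rewrite (walk3 u a b v) ?domN ?ub // e_sym.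
- by apply/negbTE/(no_triangle u a v); [|rewrite e_sym]; rewrite domN ?ub ?vb.
Qed.

Section ShortestCycle.
Variables (n : nat) (phi : nat -> T).
Local Notation g := n.+1.
Hypotheses (g_gt2 : (2 < g)%N) (phi_cyc : cycle_param e g phi).
Hypothesis g_min : forall k, has_cycle e k -> (g <= k)%N.

Let adjE := shortest_cycle_adj e_sym e_irr g_gt2 phi_cyc g_min.

Lemma neg_inertia_girth :
  (uphalf g - ((g %% 4 == 0) || (g %% 4 == 1)) <= neg_inertia R e)%N.
Proof.
apply: (leq_neg_inertia_pullback e_sym (m := g) (psi := phi)); last exact: neg_subspace_cycle.
move=> x; rewrite -sum_cycle_graph //.
by apply: eq_bigr => i _; apply: eq_bigr => j _; rewrite adjE.
Qed.

Lemma cycle_param_inj : injective (fun i : 'I_g => phi i).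
Proof.
move=> i j /eqP; rewrite phi_cyc.2 !modn_small ?ltn_ord // => /eqP.
exact: val_inj.
Qed.

Lemma cycle_param_bij : (forall v, exists i, v = phi i) ->
  bijective (fun i : 'I_g => phi i).
Proof.
move=> cov; apply: inj_card_bij cycle_param_inj _.
rewrite card_ord -[g]card_ord -(card_image cycle_param_inj); apply/subset_leq_card/subsetP.
move=> v _; have [i ->] := cov v; apply/imageP.
have ltg : (i %% g < g)%N by rewrite ltn_mod.
exists (Ordinal ltg) => //=; apply/eqP.
by rewrite phi_cyc.2 modn_mod.
Qed.

Lemma cycle_param_iso : (forall v, exists i, v = phi i) -> graph_iso e (@cycle_graph g).
Proof.
move=> /cycle_param_bij[f fK phiK]; exists f; first by exists (fun i : 'I_g => phi i).
by move=> x y; rewrite -{2}[x]phiK -{2}[y]phiK adjE.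
Qed.

(** By connectedness, if the cycle misses a vertex, it misses a vertex adjacent
    to the cycle. *)
Lemma not_cover_outer : ~ (forall v, exists i, v = phi i) ->
  exists v s, (forall i, v != phi i) /\ e v (phi s).
Proof.
move=> ncov; apply: contrapT => nouter; apply: ncov.
pose a := [pred u | [exists i : 'I_g, phi i == u]].
have aP u : reflect (exists i, u = phi i) (u \in a).
  apply: (iffP existsP) => [[i /eqP<-]|[i ->]]; first by exists i.
  have ltg : (i %% g < g)%N by rewrite ltn_mod.
  by exists (Ordinal ltg); rewrite phi_cyc.2 modn_mod.
have clos : closed e a.
  apply: intro_closed => [x y|x y exy /aP[s xE]]; first by rewrite !e_conn.
  case: (boolP (y \in a)) => // ya; case: nouter; exists y, s; split.
    by move=> i; apply: contraNneq ya => ->; apply/aP; exists i.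
  by rewrite -xE e_sym.
move=> v; apply/aP; rewrite -(closed_connect clos (e_conn (phi 0%N) v)).
by apply/aP; exists 0%N.
Qed.

(** The cycle is restarted at the unique neighbour [phi s] of [v]. *)
Lemma neg_inertia_outer v s : (4 < g)%N -> (forall i, v != phi i) ->
  e v (phi s) -> (uphalf g <= neg_inertia R e)%N.
Proof.
move=> g4 v_out evs; pose psi i := if (i < g)%N then phi (s + i)%N else v.
have pend : neg_subspace (pendant_form (R := R) n) (uphalf g).
  by have := neg_subspace_pendant R n.-1; rewrite -/(uphalf n.-1.+2) prednK //; lia.
apply: (leq_neg_inertia_pullback e_sym (m := g.+1) (psi := psi)) pend.
move=> x; rewrite /pendant_form mulrDr -sum_cycle_graph //.
have psi_in (i : 'I_g) : psi i = phi (s + i)%N by rewrite /psi ltn_ord.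
have psi_v : psi g = v by rewrite /psi ltnn.
have evi (i : 'I_g) : e v (phi (s + i)%N) = (i == 0%N :> nat).
  rewrite (shortest_cycle_outer e_sym g_gt2 phi_cyc g_min (s + i) g4 v_out evs).
  by rewrite -{1}[s]addn0 eqn_modDl mod0n modn_small // eq_sym.
have pick0 (c : R) : \sum_(i < g) (i == 0%N :> nat)%:R * x i * c = x 0%N * c.
  rewrite (bigD1 ord0) //= mul1r big1 ?addr0 // => i i0.
  by rewrite (_ : (i == 0%N :> nat) = false) ?mul0r //; apply/negbTE.
rewrite big_ord_recr /=.
under eq_bigr => i _ do rewrite big_ord_recr /=.
rewrite big_split /= [X in _ + _ + X]big_ord_recr /= psi_v e_irr !mul0r addr0 -addrA.
congr (_ + _).
  apply: eq_bigr => i _; apply: eq_bigr => j _.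
  by rewrite !psi_in adjE -!addnS !eqn_modDl.
rewrite (eq_bigr (fun i : 'I_g => (i == 0%N :> nat)%:R * x i * x g)) => [|i _].
  rewrite [X in _ + X](eq_bigr (fun i : 'I_g => (i == 0%N :> nat)%:R * x i * x g)) => [|i _].
    by rewrite !pick0; ring.
  by rewrite psi_in evi; ring.
by rewrite psi_in e_sym evi.
Qed.

(** Otherwise a vertex of the shortest cycle would have two neighbours on it and
    one outside, whereas all degrees in a cycle graph are at most 2. *)
Lemma cycle_graph_cover m : graph_iso e (@cycle_graph m) ->
  forall v, exists i, v = phi i.
Proof.
move=> [f f_bij fE]; apply: contrapT => /not_cover_outer[v [s [v_out evs]]].
have f_inj := bij_inj f_bij.
have nbr u : e (phi s) u -> (f u == (f (phi s)).+1 %[mod m]) || (f (phi s) == (f u).+1 %[mod m]).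
  by rewrite -fE.
have ev : e (phi s) v by rewrite e_sym.
have e1 := phi_cyc.1 s.
have e2 : e (phi s) (phi (s + n)%N).
  by rewrite adjE orbC -addnS modnDr eqxx.
have ne : phi s.+1 != phi (s + n)%N.
  by rewrite phi_cyc.2 -addn1 eqn_modDl !modn_small //; lia.
have same u w : f u = f w %[mod m] -> u = w.
  by rewrite !modn_small // => /val_inj/f_inj.
have same' u w : (f u).+1 = (f w).+1 %[mod m] -> u = w.
  by move/eqP; rewrite -(addn1 (f u)) -(addn1 (f w)) eqn_modDr => /eqP/same.
(* Each of the three neighbours follows or precedes [phi s] in the cycle graph,
   so two of them are on the same side. *)
have [/same' E|[/same' E|/same' E]] : (f (phi s.+1)).+1 = (f v).+1 %[mod m] \/
    (f (phi (s + n)%N)).+1 = (f v).+1 %[mod m] \/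
    (f (phi s.+1)).+1 = (f (phi (s + n)%N)).+1 %[mod m].
- have succ u w : f u = (f (phi s)).+1 %[mod m] -> f w = (f (phi s)).+1 %[mod m] -> u = w.
    by move=> uE wE; apply: same; rewrite uE.
  case/orP: (nbr _ e1) (nbr _ e2) (nbr _ ev) => /eqP s1 /orP[] /eqP s2 /orP[] /eqP s3;
    first [ by left; rewrite -s1
          | by right; left; rewrite -s2
          | by right; right; rewrite -s1
          | by have E := succ _ _ s1 s2; move: ne; rewrite E eqxx
          | by have E := succ _ _ s1 s3; have := v_out s.+1; rewrite E eqxx
          | by have E := succ _ _ s2 s3; have := v_out (s + n)%N; rewrite E eqxx ].
- by have := v_out s.+1; rewrite E eqxx.
- by have := v_out (s + n)%N; rewrite E eqxx.
- by move: ne; rewrite E eqxx.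
Qed.

End ShortestCycle.
End Structure.

Theorem theorem3p6 (R : realType) (T : finType) (e : rel T)
    (e_sym : symmetric e) (e_irr : irreflexive e)
    (e_conn : forall x y : T, connect e x y)
    (e_cyc : exists k : nat, has_cycle e k) :
  let g := girth e_cyc in
  (uphalf g - 1 <= neg_inertia R e)%N /\
  (neg_inertia R e = (uphalf g - 1)%N <->
     (exists n : nat, [/\ (3 <= n)%N,
                          (n %% 4)%N = 0%N \/ (n %% 4)%N = 1%N
                        & graph_iso e (@cycle_graph n)])
     \/ (exists s t : nat, (5 <= s + t)%N /\
                           graph_iso e (@complete_bipartite s t))).
Proof.
rewrite /girth; case: ex_minnP => g g_cycle g_min /=.
have [phi phi_cyc] := has_cycle_param g_cycle.
have g_gt2 : (2 < g)%N by case/andP: g_cycle.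
case: g => [//|n] in g_cycle g_min phi_cyc g_gt2 *.
have lower := neg_inertia_girth R e_sym e_irr g_gt2 phi_cyc g_min.
have lower1 : (uphalf n.+1 - 1 <= neg_inertia R e)%N.
  by apply: leq_trans lower; rewrite leq_sub2l // leq_b1.
split=> //; split=> [nE|[[m [m_ge3 m_mod isoC]]|[s [t [_ [f f_bij fE]]]]]]; last first.
- suff : (neg_inertia R e <= 1)%N by lia.
  apply: (@neg_inertia_bipartite_leq _ _ _ e_sym (fun u => if f u is inl _ then true else false)).
  by move=> u v; rewrite -fE; case: (f u); case: (f v).
- have cov := cycle_graph_cover e_sym e_irr e_conn g_gt2 phi_cyc g_min isoC.
  have cardT : #|T| = n.+1.
    by rewrite -(bij_eq_card (cycle_param_bij phi_cyc cov)) card_ord.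
  have mE : m = n.+1.
    by have [f f_bij _] := isoC; rewrite -cardT (bij_eq_card f_bij) card_ord.
  apply/eqP; rewrite eqn_leq lower1 andbT.
  by rewrite mE in m_mod isoC; apply: neg_inertia_cycle_leq.
have g_mod : (n.+1 %% 4 = 0)%N \/ (n.+1 %% 4 = 1)%N.
  move: lower; rewrite nE; do 2 (case: eqP => [|_]; first by auto).
  by move=> /=; lia.
have [cov|ncov] := pselect (forall v, exists i, v = phi i).
  by left; exists n.+1; split=> //; exact: (cycle_param_iso e_sym e_irr g_gt2 phi_cyc g_min cov).
right; have [v [s [v_out evs]]] := not_cover_outer e_sym e_conn phi_cyc ncov.
have [g_gt4|g_le4] := ltnP 4 n.+1.
  have := neg_inertia_outer R e_sym e_irr g_gt2 phi_cyc g_min g_gt4 v_out evs.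
  by rewrite nE; lia.
(* The girth [n.+1] is at most 4, and it is not 3 by [g_mod]. *)
have gE : n = 3 by lia.
have cardT : (5 <= #|T|)%N.
  rewrite ltnNge; apply/negP => cardT; apply: ncov => u.
  have [h _ hK] : bijective (fun i : 'I_n.+1 => phi i).
    by apply: inj_card_bij (cycle_param_inj phi_cyc) _; rewrite card_ord gE.
  by exists (h u); rewrite hK.
have e01 := phi_cyc.1 0%N.
have eE : forall u w, e u w = (e u (phi 1%N) != e w (phi 1%N)).
  by apply: (@neg_inertia1_bipartite R _ _ e_sym e_irr e_conn _ _ e01); rewrite nE gE.
have [p [q [pq iso]]] :=
  complete_bipartite_iso (P := fun u => e u (phi 1%N)) e01 (negbT (e_irr _)) eE.
by exists p, q; rewrite pq.
Qed.
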